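(* Suppose that $a_k$ are (strictly) increasing and $b_k\equiv0$. Then for $k\ge1$ and all $x\in\mathbb{R}$, $$S_2(\mathbf{p}_k)>0.$$ If, in addition, $k\ge2$ and for $i=3,\dots,k$ $$R_i=a_{i+1}^2a_i^2(a_{i-1}^2-a_{i-2}^2)-a_i^2a_{i-2}^2(a_i^2-a_{i-2}^2)+a_{i-2}^2a_{i-3}^2(a_i^2-a_{i-1}^2)\ge0,$$ then $S_4(\mathbf{p}_k)>0$ for all $x\in\mathbb{R}$.
   Context: $\mathbf{p}_k$ are the symmetric orthonormal polynomials defined by $\mathbf{p}_{-1}=0$, $\mathbf{p}_0=1$ and $a_k\mathbf{p}_k=x\,\mathbf{p}_{k-1}-a_{k-1}\mathbf{p}_{k-2}$, $k\ge1$, where $a_k>0$ for $k\ge1$ and $a_0=0$. The operators are $$S_2(\mathbf{p}_k)=\mathbf{p}_k^2-\frac{a_{k+1}}{a_k}\,\mathbf{p}_{k-1}\mathbf{p}_{k+1}\qquad(k\ge1),$$ $$S_4(\mathbf{p}_k)=\mathbf{p}_k^2-\frac{a_{k+1}(a_{k+1}^2+a_k^2-a_{k-1}^2-a_{k-2}^2)}{a_k(a_{k+1}^2-a_{k-2}^2)}\,\mathbf{p}_{k-1}\mathbf{p}_{k+1}+\frac{a_{k+2}a_{k+1}(a_k^2-a_{k-1}^2)}{a_ka_{k-1}(a_{k+1}^2-a_{k-2}^2)}\,\mathbf{p}_{k-2}\mathbf{p}_{k+2}\qquad(k\ge2).$$ *)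

(* Defs.v *)
From HB Require Import structures.
From mathcomp Require Import all_boot all_order all_algebra reals.

Set Implicit Arguments.
Unset Strict Implicit.
Unset Printing Implicit Defensive.

Import Order.TTheory GRing.Theory Num.Theory.
Local Open Scope ring_scope.

(* Symmetric (b_k = 0) orthonormal polynomials with recurrence coefficients
   a_k: p_0 = 1 and a_k p_k = X p_(k-1) - a_(k-1) p_(k-2) for k >= 1, the inner
   [if] supplying p_(-1) = 0. *)
Fixpoint opoly (R : realType) (a : nat -> R) (k : nat) : {poly R} :=
  if k is k1.+1 then
    (a k1.+1)^-1 *:
      ('X * opoly a k1 - a k1 *: (if k1 is k2.+1 then opoly a k2 else 0))
  else 1.

Lemma opoly_rec0 (R : realType) (a : nat -> R) :
  a 1%N != 0 -> a 1%N *: opoly a 1 = 'X * opoly a 0 - a 0%N *: 0.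
Proof. by move=> a1; rewrite scalerA mulfV // scale1r. Qed.

Lemma opoly_rec (R : realType) (a : nat -> R) (k : nat) :
  a k.+2 != 0 ->
  a k.+2 *: opoly a k.+2 = 'X * opoly a k.+1 - a k.+1 *: opoly a k.
Proof. by move=> ak; rewrite {1}[opoly a k.+2]/= scalerA mulfV // scale1r. Qed.

(* The index subtractions below are truncated: S2 is meant for k >= 1,
   S4 for k >= 2, and Rcoef for i >= 3. *)
Definition S2 (R : realType) (a : nat -> R) (k : nat) : {poly R} :=
  let p := opoly a in
  p k ^+ 2 - (a (k + 1)%N / a k) *: (p (k - 1)%N * p (k + 1)%N).

Definition S4 (R : realType) (a : nat -> R) (k : nat) : {poly R} :=
  let p := opoly a in
  p k ^+ 2
  - ((a (k + 1)%N * (a (k + 1)%N ^+ 2 + a k ^+ 2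
                     - a (k - 1)%N ^+ 2 - a (k - 2)%N ^+ 2))
     / (a k * (a (k + 1)%N ^+ 2 - a (k - 2)%N ^+ 2)))
    *: (p (k - 1)%N * p (k + 1)%N)
  + ((a (k + 2)%N * a (k + 1)%N * (a k ^+ 2 - a (k - 1)%N ^+ 2))
     / (a k * a (k - 1)%N * (a (k + 1)%N ^+ 2 - a (k - 2)%N ^+ 2)))
    *: (p (k - 2)%N * p (k + 2)%N).

Definition Rcoef (R : realType) (a : nat -> R) (i : nat) : R :=
  a (i + 1)%N ^+ 2 * a i ^+ 2 * (a (i - 1)%N ^+ 2 - a (i - 2)%N ^+ 2)
  - a i ^+ 2 * a (i - 2)%N ^+ 2 * (a i ^+ 2 - a (i - 2)%N ^+ 2)
  + a (i - 2)%N ^+ 2 * a (i - 3)%N ^+ 2 * (a i ^+ 2 - a (i - 1)%N ^+ 2).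

(* Main.v *)
Require Import Defs.
From mathcomp Require Import all_boot all_order all_algebra reals.
From mathcomp Require Import ring.
Import Order.TTheory GRing.Theory Num.Theory.
Local Open Scope ring_scope.

(** The proof exhibits suitably weighted Turan-type forms as sums of positive
    terms, by telescoping in [k]. Write [A_k] for [a_k ^+ 2] and let
    [T_k = A_k S2(p_k)]. The recurrence turns [T_k] into the quadratic form
    [A_k p_k^2 + A_k p_(k-1)^2 - x a_k p_(k-1) p_k], and eliminating [p_(k+1)]
    from [T_(k+1)] in the same way gives

      [T_(k+1) = T_k + (A_(k+1) - A_k) p_k^2,   T_1 = A_1],

    so that [T_k > 0] when [a] increases (lemma [S2w_step]).

    For [S4] the right weight is the one that makes the coefficient of
    [x^3 p_(k-1) p_k] independent of [k] up to the factor [a_k], namely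

      [W_k = A_k A_(k-1) (A_(k+1) - A_(k-2)) / (A_k - A_(k-1)) S4(p_k)].

    Writing both [W_k] and [W_(k+1)] as quadratic forms in [p_(k-1)] and [p_k],
    the terms of degree 3 and 2 in [x] cancel in their difference, and what
    remains is proportional to the form [T_k]:

      [W_(k+1) = W_k + R_(k+1) / ((A_(k+1) - A_k) (A_k - A_(k-1))) T_k]

    (lemma [S4w_step]). The induction starts from [S4(p_2) = 1]; since
    [T_k > 0], the hypothesis [R_i >= 0] keeps [W_k] positive. *)

(** The three-term recurrence solved for the value of highest index; this is
    how every polynomial is reduced to two consecutive ones. *)
Lemma horner_opolySS (R : realType) (a : nat -> R) (x : R) (k : nat) :
  (opoly a k.+2).[x] =
  (x * (opoly a k.+1).[x] - a k.+1 * (opoly a k).[x]) / a k.+2.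
Proof. by rewrite [opoly a k.+2]/= !hornerE mulrC. Qed.

Lemma horner_opoly0 (R : realType) (a : nat -> R) (x : R) :
  (opoly a 0).[x] = 1.
Proof. exact: hornerC. Qed.

Lemma horner_opoly1 (R : realType) (a : nat -> R) (x : R) :
  (opoly a 1).[x] = x / a 1%N.
Proof. by rewrite /= scaler0 subr0 mulr1 !hornerE mulrC. Qed.

Lemma horner_S2 (R : realType) (a : nat -> R) (x : R) (k : nat) :
  (S2 a k.+1).[x] = (opoly a k.+1).[x] ^+ 2
    - a k.+2 / a k.+1 * ((opoly a k).[x] * (opoly a k.+2).[x]).
Proof. by rewrite /S2 subn1 addn1 /= -/(opoly a) !hornerE. Qed.

Lemma horner_S4 (R : realType) (a : nat -> R) (x : R) (k : nat) :
  (S4 a k.+2).[x] = (opoly a k.+2).[x] ^+ 2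
    - (a k.+3 * (a k.+3 ^+ 2 + a k.+2 ^+ 2 - a k.+1 ^+ 2 - a k ^+ 2))
      / (a k.+2 * (a k.+3 ^+ 2 - a k ^+ 2))
      * ((opoly a k.+1).[x] * (opoly a k.+3).[x])
    + (a k.+4 * a k.+3 * (a k.+2 ^+ 2 - a k.+1 ^+ 2))
      / (a k.+2 * a k.+1 * (a k.+3 ^+ 2 - a k ^+ 2))
      * ((opoly a k).[x] * (opoly a k.+4).[x]).
Proof.
rewrite /S4 (_ : (k.+2 + 1 = k.+3)%N) ?addn1 // (_ : (k.+2 + 2 = k.+4)%N) ?addn2 //.
rewrite (_ : (k.+2 - 1 = k.+1)%N) ?subn1 // (_ : (k.+2 - 2 = k)%N) ?subn2 //.
by move: (opoly a) => p; rewrite !hornerE.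
Qed.

Lemma RcoefE (R : realType) (a : nat -> R) (k : nat) :
  Rcoef a k.+3 = a k.+4 ^+ 2 * a k.+3 ^+ 2 * (a k.+2 ^+ 2 - a k.+1 ^+ 2)
    - a k.+3 ^+ 2 * a k.+1 ^+ 2 * (a k.+3 ^+ 2 - a k.+1 ^+ 2)
    + a k.+1 ^+ 2 * a k ^+ 2 * (a k.+3 ^+ 2 - a k.+2 ^+ 2).
Proof. by rewrite /Rcoef addn1 subn1 subn2 !subSS subn0. Qed.

(** The form [T_k] of the outline above. *)
Definition S2w {R : realType} (a : nat -> R) (x : R) (k : nat) : R :=
  a k ^+ 2 * (S2 a k).[x].

(** The form [W_k] of the outline above; for [a_0 = 0] followed by positive
    increasing coefficients and [k >= 2] its weight is positive, so it has the
    sign of [S4(p_k)]. *)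
Definition S4w {R : realType} (a : nat -> R) (x : R) (k : nat) : R :=
  a k ^+ 2 * a k.-1 ^+ 2 * (a k.+1 ^+ 2 - a k.-2 ^+ 2)
    / (a k ^+ 2 - a k.-1 ^+ 2) * (S4 a k).[x].

Lemma S2w1 (R : realType) (a : nat -> R) (x : R) :
  a 1%N != 0 -> a 2%N != 0 -> S2w a x 1 = a 1%N ^+ 2.
Proof.
move=> a1 a2.
rewrite /S2w horner_S2 horner_opolySS horner_opoly1 horner_opoly0.
by field; rewrite a1 a2.
Qed.

(** Both sides are quadratic forms in [p_k] and [p_(k+1)]; passing from one to
    the other only replaces the weight of [p_(k+1) ^+ 2]. *)
Lemma S2w_step (R : realType) (a : nat -> R) (x : R) (k : nat) :
  a k.+1 != 0 -> a k.+2 != 0 -> a k.+3 != 0 ->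
  S2w a x k.+2 =
  S2w a x k.+1 + (a k.+2 ^+ 2 - a k.+1 ^+ 2) * (opoly a k.+1).[x] ^+ 2.
Proof.
move=> a1 a2 a3; rewrite /S2w !horner_S2 !horner_opolySS.
move: (opoly a k.+1).[x] (opoly a k).[x] => u v.
by field; rewrite a1 a2 a3.
Qed.

(** With [a_0 = 0] the recurrence reads [a_1 p_1 = x p_0], and the positive
    powers of [x] in the three terms of [S4(p_2)] cancel. *)
Lemma S4_2 (R : realType) (a : nat -> R) (x : R) :
  a 0%N = 0 -> a 1%N != 0 -> a 2%N != 0 -> a 3%N != 0 -> a 4%N != 0 ->
  (S4 a 2).[x] = 1.
Proof.
move=> a0 a1 a2 a3 a4.
rewrite horner_S4 !horner_opolySS horner_opoly1 horner_opoly0 a0.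
by field; rewrite ?a1 ?a2 ?a3 ?a4 ?subr0 ?expf_neq0.
Qed.

(** With [k] for the index [k.+2] of the statement, [W_k] and [W_(k+1)] have
    the same terms of degree 3 and 2 in [x] as forms in [p_(k-1)] and [p_k], and
    the remaining differences of the coefficients of [p_(k-1) ^+ 2], [p_k ^+ 2]
    and [x p_(k-1) p_k] are all governed by one scalar,

      [C = A_(k+1) (A_(k+2) - A_(k-1)) / (A_(k+1) - A_k)
           - A_(k-1) (A_(k+1) - A_(k-2)) / (A_k - A_(k-1))],

    which is [R_(k+1)] over the common denominator. *)
Lemma S4w_step (R : realType) (a : nat -> R) (x : R) (k : nat) :
  (forall i, 0 < a i.+1) -> (forall i, a i ^+ 2 < a i.+1 ^+ 2) ->
  S4w a x k.+3 = S4w a x k.+2 +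
    Rcoef a k.+3 / ((a k.+3 ^+ 2 - a k.+2 ^+ 2) * (a k.+2 ^+ 2 - a k.+1 ^+ 2))
    * S2w a x k.+2.
Proof.
move=> apos ainc.
have nz i : a i.+1 != 0 by rewrite gt_eqF.
have d1 i : a i.+1 ^+ 2 - a i ^+ 2 != 0 by rewrite subr_eq0 gt_eqF.
have d3 i : a i.+3 ^+ 2 - a i ^+ 2 != 0.
  rewrite subr_eq0 gt_eqF //.
  exact: lt_trans (ainc i) (lt_trans (ainc i.+1) (ainc i.+2)).
rewrite /S4w /S2w RcoefE !horner_S4 horner_S2 -!pred_Sn !horner_opolySS.
move: (opoly a k.+1).[x] (opoly a k).[x] => u v.
by field; rewrite !nz !d1 !d3.
Qed.

Lemma S2w_gt0 (R : realType) (a : nat -> R) (x : R) (k : nat) :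
  (forall i, 0 < a i.+1) -> (forall i, a i ^+ 2 < a i.+1 ^+ 2) ->
  0 < S2w a x k.+1.
Proof.
move=> apos ainc; have nz i : a i.+1 != 0 by rewrite gt_eqF.
elim: k => [|k IHk]; first by rewrite S2w1 ?exprn_gt0.
by rewrite S2w_step // ltr_pwDl // mulr_ge0 ?sqr_ge0 // subr_ge0 ltW.
Qed.

Lemma S4w_gt0 (R : realType) (a : nat -> R) (x : R) (k : nat) :
  a 0%N = 0 ->
  (forall i, 0 < a i.+1) -> (forall i, a i ^+ 2 < a i.+1 ^+ 2) ->
  (forall i, (3 <= i <= k.+2)%N -> 0 <= Rcoef a i) ->
  0 < S4w a x k.+2.
Proof.
move=> a0 apos ainc; have nz i : a i.+1 != 0 by rewrite gt_eqF.
have dpos i : 0 < a i.+1 ^+ 2 - a i ^+ 2 by rewrite subr_gt0.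
elim: k => [|k IHk] hR.
  rewrite /S4w S4_2 // mulr1 divr_gt0 //= !mulr_gt0 ?exprn_gt0 //.
  by rewrite a0 expr0n subr0 exprn_gt0.
rewrite S4w_step // ltr_pwDl //.
  by apply: IHk => i /andP[i3 ik]; apply: hR; rewrite i3 leqW.
rewrite mulr_ge0 ?(ltW (S2w_gt0 _ _ _ _ _ _)) // divr_ge0 ?hR ?leqnn //.
by rewrite mulr_ge0 ?ltW.
Qed.

Theorem theorem9 (R : realType) (a : nat -> R)
    (ha0 : a 0%N = 0)
    (hapos : forall k : nat, (1 <= k)%N -> 0 < a k)
    (hainc : forall k : nat, (1 <= k)%N -> a k < a k.+1) :
  (forall k : nat, (1 <= k)%N -> forall x : R, 0 < (S2 a k).[x]) /\
  (forall k : nat, (2 <= k)%N ->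
     (forall i : nat, (3 <= i <= k)%N -> 0 <= Rcoef a i) ->
     forall x : R, 0 < (S4 a k).[x]).
Proof.
have apos i : 0 < a i.+1 by apply: hapos.
have ainc i : a i ^+ 2 < a i.+1 ^+ 2.
  case: i => [|i]; first by rewrite ha0 expr0n exprn_gt0.
  by rewrite ltrXn2r // ?hainc // ltW.
split=> [[//|k] _ x|[|[|k]] // _ hR x].
  by have := S2w_gt0 R a x k apos ainc; rewrite /S2w pmulr_rgt0 // exprn_gt0.
have := S4w_gt0 R a x k ha0 apos ainc hR; rewrite /S4w pmulr_rgt0 //.
rewrite divr_gt0 ?subr_gt0 //= !mulr_gt0 ?exprn_gt0 // subr_gt0.
exact: lt_trans (ainc k) (lt_trans (ainc k.+1) (ainc k.+2)).
Qed.
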